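(* Let $C$ be the subgroup of $PL_2^+(\mathbb{R})$ generated by $x_0,x_1,w_0,w_1$, let $F_x=\langle x_0,x_1\rangle$ and $F_w=\langle w_0,w_1\rangle$. Then $F_x$ is quadratically distorted in $C$, i.e. there are constants $\kappa_1,\kappa_2>0$ such that the distortion function $\delta$ of $F_x$ in $C$ satisfies $\kappa_1 n^2\le\delta(n)\le\kappa_2 n^2$ for all integers $n\ge 1$; and $F_w$ is undistorted in $C$, i.e. there is a constant $K>0$ such that $|x|_{F_w}\le K|x|_C$ for all $x\in F_w$.
   Context: $PL_2^+(\mathbb{R})$ is the group of orientation-preserving piecewise-linear homeomorphisms of $\mathbb{R}$ whose breakpoints form a discrete (possibly infinite) set of points of $\mathbb{Z}[\tfrac12]$ and whose slopes are powers of $2$. Thompson's group $F$ is the group of orientation-preserving piecewise-linear homeomorphisms of $[0,1]$ with finitely many breakpoints, all in $\mathbb{Z}[\tfrac12]$, and slopes powers of $2$. It is generated by two elements $f_0,f_1$: $f_0$ maps $[0,\frac14],[\frac14,\frac12],[\frac12,1]$ affinely onto $[0,\frac12],[\frac12,\frac34],[\frac34,1]$ respectively, and $f_1$ is the identity on $[0,\frac12]$ and is the copy of $f_0$ rescaled to $[\frac12,1]$ on that interval. $F$ is identified (by conjugating by a piecewise-linear homeomorphism $(0,1)\to\mathbb{R}$ sending $\frac12\mapsto 0$, $1-2^{-k-1}\mapsto k$ and $2^{-k-1}\mapsto -k$ for integers $k\geq 0$, affine in between) with the subgroup $F_x$ of $PL_2^+(\mathbb{R})$ of those $f$ for which there are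 $M>0$ and integers $k,l$ with $f(u)=u+k$ for all $u>M$ and $f(u)=u+l$ for all $u<-M$. Under this identification $f_0,f_1$ become $x_0,x_1$: $x_0(u)=u+1$ for all $u\in\mathbb{R}$; $x_1(u)=u$ for $u\le 0$, $x_1(u)=2u$ for $0\le u\le1$, $x_1(u)=u+1$ for $u\ge1$. So $F_x=\langle x_0,x_1\rangle\cong F$. For $f\in F$, let $\sigma(f)\in PL_2^+(\mathbb{R})$ be the periodic map $\sigma(f)(k+u)=k+f(u)$ for $k\in\mathbb{Z}$, $u\in[0,1]$. Set $w_0=\sigma(f_0)$, $w_1=\sigma(f_1)$; so $F_w=\langle w_0,w_1\rangle=\sigma(F)\cong F$. The subgroup $F_x$ is normal in $C$ and $C=F_x\rtimes F_w$. For a finitely generated group $G$ with fixed finite generating set, $|g|_G$ denotes word length; here one may use the generating sets $\{x_0,x_1,w_0,w_1\}$ for $C$, $\{x_0,x_1\}$ for $F_x$, $\{w_0,w_1\}$ for $F_w$. The distortion function of a finitely generated subgroup $H<G$ is $\delta(n)=\max\{|x|_H: x\in H,\ |x|_G\le n\}$. *)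

(* Defs.v *)
From HB Require Import structures.
From mathcomp Require Import all_boot all_order all_algebra.
From mathcomp Require Import all_classical all_reals all_analysis.
From mathcomp Require Import ring lra.

Set Implicit Arguments.
Unset Strict Implicit.
Unset Printing Implicit Defensive.

Import Order.TTheory GRing.Theory Num.Theory.
Import numFieldNormedType.Exports.

Local Open Scope classical_set_scope.
Local Open Scope ring_scope.

Section WordMetric.
Variable G : groupType.
Implicit Types (S T : set G) (x : G) (n m : nat).

Definition generated S : set G :=
  smallest (fun H : set G => group_closed [in H]) S.

Definition has_word S x n : Prop :=
  exists s : seq G, [/\ size s = n,
    (forall y, y \in s -> S y \/ S (y^-1)%g) & (\prod_(y <- s) y)%g = x].

(* Both [word_length] and [distortion] take the junk value 0 when the minimum,
   resp. the maximum, does not exist; see [word_lengthP] and [distortionP]. *)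
Definition word_length S x : nat :=
  xget 0%N [set n | has_word S x n /\
                    forall m, has_word S x m -> (n <= m)%N].

Definition distortion_values S T n : set nat :=
  [set m | exists x, [/\ generated T x, (word_length S x <= n)%N &
                         word_length T x = m]].

(* The distortion function of <T> in <S>, for T included in <S>. *)
Definition distortion S T n : nat :=
  xget 0%N [set m | distortion_values S T n m /\
                    forall k, distortion_values S T n k -> (k <= m)%N].

Lemma generatedP S x : generated S x <-> exists n, has_word S x n.
Proof.
split.
  move=> /(_ [set y | exists n, has_word S y n]); apply; split; last first.
    move=> y Sy; exists 1%N, [:: y]; split=> //; last by rewrite big_seq1.
    by move=> z; rewrite inE => /eqP ->; left.
  split.
    by rewrite inE; exists 0%N, [::]; split=> //; rewrite big_nil.
  move=> y z; rewrite !inE => -[n [s [_ sS <-]]] [m [t [_ tS <-]]].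
  exists (size (s ++ rev [seq (z^-1)%g | z <- t])), (s ++ rev [seq (z^-1)%g | z <- t]).
  split=> //.
    move=> u; rewrite mem_cat mem_rev => /orP[/sS//|/mapP[v /tS vS ->]].
    by rewrite invgK; case: vS; [right|left].
  rewrite big_cat /=; congr (_ * _)%g.
  rewrite -map_rev big_map prodgV; congr (_^-1)%g.
  by rewrite revK.
move=> [n [s [_ sS <-]]] H [Hg SH].
have H1 : H 1%g by have [+ _] := Hg; rewrite inE.
have HM y z : H y -> H z -> H (y * z)%g.
  by move=> Hy Hz; have := group_closedM Hg; move/(_ y z); rewrite !inE; apply.
have HV y : H y -> H (y^-1)%g.
  by move=> Hy; have := group_closedV Hg; move/(_ y); rewrite !inE; apply.
elim: s sS => [|y s IH] sS; first by rewrite big_nil.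
rewrite big_cons; apply: HM; last first.
  by apply: IH => z zs; apply: sS; rewrite inE zs orbT.
case: (sS y (mem_head _ _)) => /SH // /HV; by rewrite invgK.
Qed.

Lemma word_lengthP S x : generated S x ->
  has_word S x (word_length S x) /\
  forall m, has_word S x m -> (word_length S x <= m)%N.
Proof.
move=> /generatedP [n0 n0P]; rewrite /word_length.
case: xgetP => [y _ [//]|/= abs].
have ex : exists n, `[< has_word S x n >] by exists n0; apply/asboolP.
case: (ex_minnP ex) => m /asboolP mP minm; exfalso; apply: (abs m).
by split=> // k kP; apply: minm; apply/asboolP.
Qed.

Lemma distortionP S T n : finite_set S -> T `<=` generated S ->
  distortion_values S T n (distortion S T n) /\
  forall k, distortion_values S T n k -> (k <= distortion S T n)%N.
Proof.
move=> finS TS.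
have genTS : generated T `<=` generated S.
  apply: smallest_sub => //; split.
    by rewrite inE; apply/generatedP; exists 0%N, [::]; rewrite big_nil.
  move=> x y; rewrite !inE => Sx Sy H HS.
  have := HS.1.2 x y; rewrite !inE; apply; [exact: Sx|exact: Sy].
pose L := S `|` (fun x : G => x^-1)%g @` S.
have finL : finite_set L by rewrite finite_setU; split=> //; exact: finite_image.
pose B k := [set x | exists2 s : seq G, (size s <= k)%N &
               (forall y, y \in s -> L y) /\ (\prod_(y <- s) y)%g = x].
have finB k : finite_set (B k).
  elim: k => [|k IH].
    apply: (@sub_finite_set _ _ [set 1%g]) => // x [s].
    by rewrite leqn0 size_eq0 => /eqP -> [_ <-]; rewrite big_nil.
  apply: (@sub_finite_set _ _
      ([set 1%g] `|` (fun p => p.1 * p.2)%g @` (L `*` B k))).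
    move=> x [[|y s] /= sk [sL <-]]; first by left; rewrite big_nil.
    right; exists (y, (\prod_(z <- s) z)%g) => /=; last by rewrite big_cons.
    split; first exact/sL/mem_head.
    by exists s => //; split=> // z zs; apply: sL; rewrite inE zs orbT.
  by rewrite finite_setU; split=> //; exact/finite_image/finite_setX.
have finV : finite_set (distortion_values S T n).
  apply: (@sub_finite_set _ _ (word_length T @` B n)); last exact: finite_image.
  move=> m [x [Tx xn <-]]; exists x => //.
  have [[s [ss sS sx]] _] := word_lengthP (genTS _ Tx).
  exists s; first by rewrite ss.
  split=> // y /sS [|Sy]; first by left.
  by right; exists (y^-1)%g => //; rewrite invgK.
rewrite /distortion; case: xgetP => [y _ [//]|/= abs]; exfalso.
have gT1 : generated T 1%g.
  by apply/generatedP; exists 0%N, [::]; rewrite big_nil.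
have v0 : distortion_values S T n (word_length T 1%g).
  exists 1%g; split=> //.
  have [_ h] := word_lengthP (genTS _ gT1).
  by apply: (@leq_trans 0%N) => //; apply: h; exists [::]; rewrite big_nil.
have [s sP] := (finite_seqP _).1 finV.
have ex : exists m, `[< distortion_values S T n m >].
  by exists (word_length T 1%g); apply/asboolP.
have bd m : `[< distortion_values S T n m >] -> (m <= \max_(i <- s) i)%N.
  move=> /asboolP; rewrite sP /= => ms.
  by rewrite (big_rem _ ms) /= leq_maxl.
case: (ex_maxnP ex bd) => m /asboolP mP maxm; apply: (abs m).
by split=> // k kP; apply: maxm; apply/asboolP.
Qed.

End WordMetric.

Section PL2.
Variable R : realType.
Implicit Types (f g : R -> R) (x y a b c d : R).

Definition dyadic : set R :=
  [set x | exists (p : int) (n : nat), x = p%:~R / 2 ^+ n].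

Definition affine_near f x a b : Prop := \forall y \near x, f y = a * y + b.

(* The complement of [breakpoints f] is open by construction, so a discrete set
   of breakpoints is automatically locally finite. *)
Definition breakpoints f : set R :=
  [set x | ~ exists a b, affine_near f x a b].

(* [PL2_dyadic] is not implied by the other conditions (they all hold for the
   translation by 1/3), but without it they do not define a group. *)
Record is_PL2 f : Prop := {
  PL2_increasing : {homo f : x y / x < y};
  PL2_homeo : exists g, [/\ continuous f, continuous g, cancel f g & cancel g f];
  PL2_breakpoints_discrete : breakpoints f `<=` isolated (breakpoints f);
  PL2_breakpoints_dyadic : breakpoints f `<=` dyadic;
  PL2_slopes : forall x a b, affine_near f x a b -> exists k : int, a = 2 ^ k;
  PL2_dyadic : forall x, dyadic (f x) <-> dyadic x }.

Lemma affine_near_uniq f x a b c d :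
  affine_near f x a b -> affine_near f x c d -> a = c.
Proof.
move=> h1 h2.
have : \forall y \near x, a * y + b = c * y + d.
  by near=> y; rewrite -(near h1 y)// -(near h2 y).
move=> /nbhs_ballP[e /= e0 he].
have hx := he x (ballxx _ e0).
have : ball x e (x + e / 2).
  by rewrite /ball /= opprD addrA subrr sub0r normrN gtr0_norm; lra.
move=> /he /=; move: hx => /= hx hxe.
have : (a - c) * (e / 2) = 0 by nra.
move/eqP; rewrite mulf_eq0 => /orP[|/eqP]; first by rewrite subr_eq0 => /eqP.
by move=> he0; lra.
Unshelve. all: by end_near. Qed.

Lemma affine_near_comp f g x a b c d : {for x, continuous g} ->
  affine_near f (g x) a b -> affine_near g x c d ->
  affine_near (f \o g) x (a * c) (a * d + b).
Proof.
move=> cg hf hg.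
have hfg : \forall y \near x, f (g y) = a * g y + b by exact: (cg _ hf).
rewrite /affine_near; near=> y.
rewrite /= (near hfg y)//.
by rewrite (near hg y)//; ring.
Unshelve. all: by end_near. Qed.

Lemma affine_near_inv f g y a b : a != 0 -> cancel g f ->
  {for y, continuous g} -> affine_near f (g y) a b ->
  affine_near g y a^-1 (- (a^-1 * b)).
Proof.
move=> a0 gf cg hf.
have hfg : \forall z \near y, f (g z) = a * g z + b by exact: (cg _ hf).
rewrite /affine_near; near=> z.
have e : z = a * g z + b by rewrite -[LHS]gf (near hfg z).
apply: (mulfI a0); transitivity (z - b); first by rewrite {2}e addrK.
by field.
Unshelve. all: by end_near. Qed.

Lemma affine_near_neq0 f x a b :
  {homo f : x y / x < y} -> affine_near f x a b -> a != 0.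
Proof.
move=> hf /nbhs_ballP[e /= e0 he]; apply/eqP => a0.
have hx := he x (ballxx _ e0).
have : ball x e (x + e / 2).
  by rewrite /ball /= opprD addrA subrr sub0r normrN gtr0_norm; lra.
move=> /he /=; move: hx => /= hx hxe.
have : f x < f (x + e / 2) by apply: hf; lra.
by rewrite hx hxe a0 !mul0r ltxx.
Qed.

Lemma affine_near_near f x a b :
  affine_near f x a b -> \forall y \near x, affine_near f y a b.
Proof. exact: near_join. Qed.

Lemma discreteP f : breakpoints f `<=` isolated (breakpoints f) <->
  forall x, \forall y \near x, y != x -> ~ breakpoints f y.
Proof.
split=> h x.
  have [Bx|nB] := pselect (breakpoints f x).
    have := h _ Bx; rewrite /isolated => -[_ [V xV VB]].
    near=> y => yx By.
    have : (V `&` breakpoints f) y by split=> //; near: y.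
    by rewrite VB /= => yx'; rewrite yx' eqxx in yx.
  move: nB => /contrapT [a [b /affine_near_near hab]].
  by near=> y => _ By; case: By; exists a, b; near: y.
move=> Bx; rewrite /isolated; split; first by rewrite inE.
exists [set y | y != x -> ~ breakpoints f y]; first exact: h.
apply/seteqP; split=> y /=; last by move=> ->; split=> //; rewrite eqxx.
by move=> [hy By]; apply: contrapT => /eqP /hy.
Unshelve. all: by end_near. Qed.

Lemma near_exists_neq (P : R -> Prop) x :
  (\forall y \near x, P y) -> exists2 y, y != x & P y.
Proof.
move=> /nbhs_ballP[e /= e0 he]; exists (x + e / 2).
  by apply/eqP; lra.
by apply: he; rewrite /ball /= opprD addrA subrr sub0r normrN gtr0_norm; lra.
Qed.

Lemma is_PL2_id : is_PL2 id.
Proof.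
have laf x : affine_near id x 1 0 by near=> y; rewrite mul1r addr0.
have nB x : ~ breakpoints id x by move=> Bx; apply: Bx; exists 1, 0.
split=> //.
- by exists id; split=> // x; exact: cvg_id.
- by move=> x /nB.
- by move=> x /nB.
- by move=> x a b /affine_near_uniq /(_ (laf x)) ->; exists 0.
Unshelve. all: by end_near. Qed.

Lemma is_PL2_comp f g : is_PL2 f -> is_PL2 g -> is_PL2 (f \o g).
Proof.
move=> [fi [f' [fc fc' ff' f'f]] fd fD fs fdy] [gi [g' [gc gc' gg' g'g]] gd gD gs gdy].
have nB x : ~ breakpoints g x -> ~ breakpoints f (g x) -> ~ breakpoints (f \o g) x.
  move=> /contrapT [c [d h]] /contrapT [a [b h']] B; apply: B.
  by exists (a * c), (a * d + b); apply: affine_near_comp => //; exact: gc.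
have iso x : \forall y \near x, y != x ->
    ~ breakpoints g y /\ ~ breakpoints f (g y).
  have hg := (discreteP g).1 gd x.
  have hf : \forall y \near x, g y != g x -> ~ breakpoints f (g y).
    by exact: (gc x _ ((discreteP f).1 fd (g x))).
  near=> y => yx; split; first by apply: (near hg y).
  by apply: (near hf y) => //; rewrite (can_eq gg').
split.
- by move=> x y xy; apply/fi/gi.
- exists (g' \o f'); split; last 2 first.
  + by move=> x /=; rewrite ff' gg'.
  + by move=> x /=; rewrite g'g f'f.
  + by move=> x; apply: continuous_comp; [exact: gc|exact: fc].
  + by move=> x; apply: continuous_comp; [exact: fc'|exact: gc'].
- apply/discreteP => x; have hx := iso x.
  by near=> y => yx; have [//|? ?] := near hx y _ yx; exact: nB.
- move=> x Bx; have [/gD//|nBg] := pselect (breakpoints g x).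
  have [/fD|nBf] := pselect (breakpoints f (g x)); first by move/gdy.
  by case: (nB _ nBg nBf Bx).
- move=> x a b /affine_near_near hab.
  have : \forall y \near x, affine_near (f \o g) y a b /\
      (y != x -> ~ breakpoints g y /\ ~ breakpoints f (g y)).
    have hx := iso x; near=> y; split; first by near: y.
    by apply: (near hx y).
  move=> /near_exists_neq[y yx [haby /(_ yx)]].
  move=> [/contrapT [a1 [b1 h1]] /contrapT [a2 [b2 h2]]].
  have /affine_near_uniq /(_ haby) <- := affine_near_comp (gc y) h2 h1.
  have [k ->] := gs _ _ _ h1; have [l ->] := fs _ _ _ h2.
  by exists (l + k); rewrite expfzDr// pnatr_eq0.
- by move=> x; split=> [/fdy /gdy|/gdy /fdy].
Unshelve. all: by end_near. Qed.

Lemma is_PL2_inv f g : is_PL2 f -> cancel f g -> cancel g f -> is_PL2 g.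
Proof.
move=> [fi [f' [fc fc' ff' f'f]] fd fD fs fdy] fg gf.
have -> : g = f'.
  by apply/funext => y; rewrite -{1}(f'f y) fg.
move: f'f => gf' {g fg gf}; set g := f' in fc' ff' gf' *; clearbody g; clear f'.
have gi : {homo g : x y / x < y}.
  move=> x y xy; rewrite ltNge; apply/negP => h.
  move: xy; apply/negP; rewrite -leNgt -(gf' x) -(gf' y).
  by move: h; rewrite le_eqVlt => /orP[/eqP ->//|/fi /ltW].
have nB y : ~ breakpoints f (g y) -> ~ breakpoints g y.
  move=> /contrapT [a [b h]] B; apply: B; exists a^-1, (- (a^-1 * b)).
  by apply: affine_near_inv (h) => //; [exact: affine_near_neq0 (h)|exact: fc'].
split=> //.
- by exists f; split.
- apply/discreteP => y.
  have hf : \forall z \near y, g z != g y -> ~ breakpoints f (g z).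
    by exact: (fc' y _ ((discreteP f).1 fd (g y))).
  near=> z => zy; apply: nB; apply: (near hf z) => //.
  by rewrite (can_eq gf').
- move=> y By; have [/fD|/nB//] := pselect (breakpoints f (g y)).
  by move/fdy; rewrite gf'.
- move=> y a b h; have a0 := affine_near_neq0 gi h.
  have : affine_near f (g y) a^-1 (- (a^-1 * b)).
    by apply: (@affine_near_inv g) => //; [exact: fc|rewrite gf'].
  move=> /fs[k /(congr1 GRing.inv)]; rewrite invrK => ->.
  by exists (- k); rewrite invr_expz.
- by move=> x; split=> [/fdy|?]; [rewrite gf'|apply/fdy; rewrite gf'].
Unshelve. all: by end_near. Qed.

Record PL2 : Type := MkPL2 { PL2_fun :> R -> R; _ : `[< is_PL2 PL2_fun >] }.

HB.instance Definition _ := [isSub for PL2_fun].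
HB.instance Definition _ := [Choice of PL2 by <:].

Lemma PL2P (f : PL2) : is_PL2 f. Proof. by apply/asboolP; exact: (valP f). Qed.

Definition toPL2 f (fP : is_PL2 f) : PL2 := MkPL2 (asboolT fP).

Lemma PL2_inverse (f : PL2) : {g : PL2 | cancel f g & cancel g f}.
Proof.
have [g [_ _ fg gf]] := cid (PL2_homeo (PL2P f)).
by exists (toPL2 (is_PL2_inv (PL2P f) fg gf)).
Qed.

Definition PL2_one : PL2 := toPL2 is_PL2_id.
Definition PL2_mul (f g : PL2) : PL2 := toPL2 (is_PL2_comp (PL2P f) (PL2P g)).
Definition PL2_inv (f : PL2) : PL2 := s2val (PL2_inverse f).

Lemma PL2_eq (f g : PL2) : f =1 g -> f = g.
Proof. by move=> fg; apply: val_inj; apply/funext. Qed.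

Lemma PL2_mulA : associative PL2_mul.
Proof. by move=> f g h; exact: PL2_eq. Qed.
Lemma PL2_mul1 : left_id PL2_one PL2_mul.
Proof. by move=> f; exact: PL2_eq. Qed.
Lemma PL2_mulr1 : right_id PL2_one PL2_mul.
Proof. by move=> f; exact: PL2_eq. Qed.
Lemma PL2_mulV : left_inverse PL2_one PL2_inv PL2_mul.
Proof. by move=> f; apply: PL2_eq => x; exact: (s2valP (PL2_inverse f)). Qed.
Lemma PL2_mulrV : right_inverse PL2_one PL2_inv PL2_mul.
Proof. by move=> f; apply: PL2_eq => x; exact: (s2valP' (PL2_inverse f)). Qed.

HB.instance Definition _ := isGroup.Build PL2
  PL2_mulA PL2_mul1 PL2_mulr1 PL2_mulV PL2_mulrV.

(* A sufficient criterion for [is_PL2]: f is affine on both sides of every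
   point, with slopes 2 ^ k and 2 ^ l. *)
Definition has_germs f x (k l : int) : Prop :=
  exists2 e : R, 0 < e & forall h, 0 < h < e ->
    f (x + h) = f x + 2 ^ k * h /\ f (x - h) = f x - 2 ^ l * h.

Lemma increasing_onto_continuous f : {homo f : x y / x < y} ->
  (forall y, exists x, f x = y) -> continuous f.
Proof.
move=> fi fs x.
have fle : {mono f : x y / x <= y} := le_mono fi.
have flt : {mono f : x y / x < y} := leW_mono fle.
apply/cvgrPdist_lt => e e0.
have [a fa] := fs (f x - e); have [b fb] := fs (f x + e).
have ax : a < x by rewrite -flt fa; lra.
have xb : x < b by rewrite -flt fb; lra.
have xab : x \in `]a, b[ by rewrite in_itv /= ax xb.
near=> y.
have : y \in `]a, b[ by near: y; exact: near_in_itvoo.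
rewrite in_itv /= => /andP[]; rewrite -flt -(flt y) fa fb => h1 h2.
by rewrite ltr_norml; apply/andP; split; lra.
Unshelve. all: by end_near. Qed.

Definition PL2_crit f : Prop :=
  [/\ {homo f : x y / x < y}, (forall y, exists x, f x = y),
     (forall x, dyadic (f x) <-> dyadic x) &
     forall x, exists k l : int, has_germs f x k l /\ (k = l \/ dyadic x)].

Lemma is_PL2_crit f : PL2_crit f -> is_PL2 f.
Proof.
move=> [fi fs fdy fg].
have fle : {mono f : x y / x <= y} := le_mono fi.
have [g gP] := choice fs.
have fgK : cancel f g.
  by move=> x; apply/eqP; rewrite eq_le -(fle _ x) -(fle x) !gP lexx.
have gi : {homo g : x y / x < y}.
  by move=> x y; rewrite -(leW_mono fle (g x)) !gP.
have fc := increasing_onto_continuous fi fs.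
have gc : continuous g.
  by apply: increasing_onto_continuous => // y; exists (f y).
have side x k l e : 0 < e -> (forall h, 0 < h < e ->
    f (x + h) = f x + 2 ^ k * h /\ f (x - h) = f x - 2 ^ l * h) ->
    forall y, ball x e y -> y != x -> exists a b, affine_near f y a b.
  move=> e0 he y; rewrite /ball /= ltr_norml => /andP[y1 y2] yx.
  have [xy|] := ltP x y.
    exists (2 ^ k), (f x - 2 ^ k * x); near=> z.
    have : z \in `]x, x + e[.
      by near: z; apply: near_in_itvoo; rewrite in_itv /=; lra.
    rewrite in_itv /= => /andP[z1 z2].
    have [|h _] := he (z - x); first by lra.
    by move: h; rewrite addrC subrK => ->; ring.
  rewrite le_eqVlt (negbTE yx) /= => xy.
  exists (2 ^ l), (f x - 2 ^ l * x); near=> z.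
  have : z \in `]x - e, x[.
    by near: z; apply: near_in_itvoo; rewrite in_itv /=; lra.
  rewrite in_itv /= => /andP[z1 z2].
  have [|_ h] := he (x - z); first by lra.
  by move: h; rewrite opprB addrC subrK => ->; ring.
split=> //.
- by exists g; split.
- apply/discreteP => x; have [k [l [[e e0 he] _]]] := fg x.
  near=> y => yx; have : exists a b, affine_near f y a b.
    by apply: (side x k l e) => //; near: y; exact: nbhsx_ballx.
  by move=> h Bx; apply: Bx.
- move=> x Bx; have [k [l [[e e0 he] [kl|//]]]] := fg x.
  case: Bx; exists (2 ^ k), (f x - 2 ^ k * x).
  apply/nbhs_ballP; exists e => //= z; rewrite /ball /= ltr_norml => /andP[z1 z2].
  have [xz|zx|->] := ltgtP x z; last by ring.
    have [|h _] := he (z - x); first by lra.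
    by move: h; rewrite addrC subrK => ->; ring.
  have [|_ h] := he (x - z); first by lra.
  by move: h; rewrite opprB addrC subrK -kl => ->; ring.
- move=> x a b /nbhs_ballP[d /= d0 hd].
  have [k [l [[e e0 he] _]]] := fg x; exists k.
  pose h := Num.min e d / 2.
  have m0 : 0 < Num.min e d by rewrite lt_min e0 d0.
  have [me md] : Num.min e d <= e /\ Num.min e d <= d by rewrite !ge_min !lexx orbT.
  have h0 : 0 < h by rewrite /h; lra.
  have [|E _] := he h; first by rewrite /h; lra.
  have := hd x (ballxx _ d0) => /= Ex.
  have : ball x d (x + h).
    by rewrite /ball /= opprD addrA subrr sub0r normrN gtr0_norm// /h; lra.
  move=> /hd /= Exh.
  have : (a - 2 ^ k) * h = 0 by nra.
  by move/eqP; rewrite mulf_eq0 (gt_eqF h0) orbF subr_eq0 => /eqP.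
Unshelve. all: by end_near. Qed.

Lemma dyadic_int (p : int) : dyadic p%:~R.
Proof. by exists p, 0%N; rewrite expr0 divr1. Qed.

Lemma dyadic_half x : dyadic x -> dyadic (x / 2).
Proof.
by move=> [p [n ->]]; exists p, n.+1; rewrite exprSr invfM mulrA.
Qed.

Lemma dyadicD x y : dyadic x -> dyadic y -> dyadic (x + y).
Proof.
move=> [p [n ->]] [q [m ->]]; exists (p * 2 ^+ m + q * 2 ^+ n), (n + m)%N.
rewrite exprD intrD !intrM !rmorphXn /=.
have hn : (2 : R) ^+ n != 0 by rewrite expf_neq0 // pnatr_eq0.
have hm : (2 : R) ^+ m != 0 by rewrite expf_neq0 // pnatr_eq0.
by field; rewrite hn hm.
Qed.

Lemma dyadicN x : dyadic x -> dyadic (- x).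
Proof. by move=> [p [n ->]]; exists (- p), n; rewrite intrN mulNr. Qed.

Lemma dyadicB x y : dyadic x -> dyadic y -> dyadic (x - y).
Proof. by move=> ? ?; apply: dyadicD => //; exact: dyadicN. Qed.

Lemma dyadicDr x y : dyadic y -> dyadic (x + y) <-> dyadic x.
Proof.
move=> dy; split=> [/dyadicB /(_ dy)|/dyadicD]; last exact.
by rewrite addrK.
Qed.

Lemma dyadic_double x : dyadic (2 * x) <-> dyadic x.
Proof.
split=> [/dyadic_half|dx]; first by rewrite mulrC mulKf// pnatr_eq0.
by rewrite mulrDl mul1r; exact: dyadicD.
Qed.

Definition x0_fun u : R := u + 1.

Definition x1_fun u : R :=
  if u <= 0 then u else if u <= 1 then 2 * u else u + 1.

(* [f0_fun] and [f1_fun] represent homeomorphisms of [0, 1]; their values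
   outside [0, 1] are irrelevant. *)
Definition f0_fun u : R :=
  if u <= 1 / 4 then 2 * u else
  if u <= 1 / 2 then u + 1 / 4 else (u + 1) / 2.

Definition f1_fun u : R :=
  if u <= 1 / 2 then u else 1 / 2 + f0_fun (2 * u - 1) / 2.

Definition sigma f u : R :=
  (Num.floor u)%:~R + f (u - (Num.floor u)%:~R).

Lemma dyadic1 : dyadic 1. Proof. exact: (dyadic_int 1). Qed.
Lemma dyadic12 : dyadic (1 / 2). Proof. exact/dyadic_half/dyadic1. Qed.
Lemma dyadic14 : dyadic (1 / 4).
Proof.
have -> : 1 / 4 = 1 / 2 / 2 :> R by field.
exact/dyadic_half/dyadic12.
Qed.
Lemma dyadic0 : dyadic 0. Proof. exact: (dyadic_int 0). Qed.

Lemma dyadic_exp (k : int) x : dyadic (2 ^ k * x) <-> dyadic x.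
Proof.
have aux (l : int) y : dyadic y -> dyadic (2 ^ l * y).
  move=> [p [m ->]]; case: l => n.
    exists (2 ^+ n * p), m; rewrite intrM rmorphXn /= mulrA.
    by rewrite -exprnP.
  exists p, (n.+1 + m)%N; rewrite NegzE -exprnN exprD invfM.
  by rewrite mulrCA.
split=> [/(aux (- k))|/aux//].
by rewrite mulrA -expfzDr ?pnatr_eq0// addNr expr0z mul1r.
Qed.

Lemma crit_affine (k : int) b : dyadic b -> PL2_crit (fun u => 2 ^ k * u + b).
Proof.
move=> db; have k0 : 0 < 2 ^ k :> R by rewrite exprz_gt0.
split.
- by move=> x y xy; rewrite ltrD2r ltr_pM2l.
- move=> y; exists ((2 ^ k)^-1 * (y - b)).
  by rewrite mulVKf ?gt_eqF// subrK.
- by move=> x; rewrite dyadicDr//; exact: dyadic_exp.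
- move=> x; exists k, k; split; last by left.
  by exists 1 => // h _; split; ring.
Qed.

Lemma crit_glue c f g : dyadic c -> f c = g c -> PL2_crit f -> PL2_crit g ->
  PL2_crit (fun u => if u <= c then f u else g u).
Proof.
move=> dc fgc [fi fs fd fg] [gi gs gd gg].
have fle := le_mono fi; have gle := le_mono gi.
split.
- move=> x y xy; case: (leP x c) => xc; case: (leP y c) => yc.
  + exact: fi.
  + apply: (@le_lt_trans _ _ (f c)); first by rewrite fle.
    by rewrite fgc; exact: gi.
  + by move: (lt_trans (le_lt_trans yc xc) xy); rewrite ltxx.
  + exact: gi.
- move=> y; have [yc|yc] := leP y (f c).
    by have [x xy] := fs y; exists x; rewrite -fle xy yc.
  have [x xy] := gs y; exists x.
  by rewrite leNgt -(leW_mono gle) xy -fgc yc.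
- by move=> x; case: ifP => _.
move=> x; have [xc|xc|->] := ltgtP x c.
- have [k [l [[e e0 he] kl]]] := fg x; exists k, l; split=> //.
  exists (Num.min e (c - x)); first by rewrite lt_min e0 subr_gt0.
  move=> h; rewrite lt_min => /and3P[h0 h1 h2].
  rewrite (ltW xc) (_ : x + h <= c); last lra.
  rewrite (_ : x - h <= c); last lra.
  by apply: he; rewrite h0.
- have [k [l [[e e0 he] kl]]] := gg x; exists k, l; split=> //.
  exists (Num.min e (x - c)); first by rewrite lt_min e0 subr_gt0.
  move=> h; rewrite lt_min => /and3P[h0 h1 h2].
  rewrite [x <= c]leNgt xc [x + h <= c]leNgt (_ : c < x + h); last lra.
  rewrite [x - h <= c]leNgt (_ : c < x - h) /=; last lra.
  by apply: he; rewrite h0.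
- have [k [l0 [[e e0 he] _]]] := gg c; have [k0 [l [[d d0 hd] _]]] := fg c.
  exists k, l; split; last by right.
  exists (Num.min e d); first by rewrite lt_min e0.
  move=> h; rewrite lt_min => /and3P[h0 h1 h2].
  rewrite lexx [c + h <= c]leNgt (_ : c < c + h) /=; last lra.
  rewrite (_ : c - h <= c); last lra.
  have [|E _] := he h; first by rewrite h0.
  have [|_ D] := hd h; first by rewrite h0.
  by rewrite fgc E -fgc D.
Qed.

Lemma crit_x0 : PL2_crit x0_fun.
Proof.
have -> : x0_fun = (fun u => 2 ^ 0 * u + 1).
  by apply/funext => u; rewrite /x0_fun expr0z; ring.
exact/crit_affine/dyadic1.
Qed.

Lemma crit_id : PL2_crit id.
Proof.
have -> : id = (fun u => 2 ^ 0 * u + 0) :> (R -> R).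
  by apply/funext => u; rewrite expr0z /=; ring.
exact/crit_affine/dyadic0.
Qed.

Lemma crit_double : PL2_crit (fun u => 2 * u).
Proof.
have -> : (fun u => 2 * u) = (fun u => 2 ^ 1 * u + 0) :> (R -> R).
  by apply/funext => u; rewrite expr1z /=; ring.
exact/crit_affine/dyadic0.
Qed.

Lemma crit_x1 : PL2_crit x1_fun.
Proof.
apply: (@crit_glue _ id); [exact: dyadic0| |exact: crit_id|].
  by rewrite ler01 mulr0.
apply: (@crit_glue _ (fun u => 2 * u) x0_fun).
- exact: dyadic1.
- by rewrite /x0_fun; ring.
- exact: crit_double.
- exact: crit_x0.
Qed.

Lemma crit_f0 : PL2_crit f0_fun.
Proof.
apply: (@crit_glue _ (fun u => 2 * u)); [exact: dyadic14| |exact: crit_double|].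
  by rewrite (_ : 1 / 4 <= 1 / 2 :> R); lra.
apply: (@crit_glue _ (fun u => u + 1 / 4) (fun u => (u + 1) / 2)).
- exact: dyadic12.
- by field.
- have -> : (fun u => u + 1 / 4) = (fun u => 2 ^ 0 * u + 1 / 4) :> (R -> R).
    by apply/funext => u; rewrite expr0z /=; ring.
  exact/crit_affine/dyadic14.
- have -> : (fun u => (u + 1) / 2) = (fun u => 2 ^ (- 1) * u + 1 / 2) :> (R -> R).
    by apply/funext => u; rewrite exprN1 /=; field.
  exact/crit_affine/dyadic12.
Qed.

Lemma crit_rescale f : PL2_crit f ->
  PL2_crit (fun u => 1 / 2 + f (2 * u - 1) / 2).
Proof.
move=> [fi fs fd fg]; split.
- by move=> x y xy; have := fi (2 * x - 1) (2 * y - 1); lra.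
- move=> y; have [x xy] := fs (2 * y - 1); exists ((x + 1) / 2).
  have -> : 2 * ((x + 1) / 2) - 1 = x by field.
  by rewrite xy; field.
- move=> x; rewrite addrC dyadicDr; last exact: dyadic12.
  rewrite -dyadic_double [2 * _]mulrC divfK ?pnatr_eq0// fd.
  by rewrite dyadicDr ?dyadic_double//; exact/dyadicN/dyadic1.
- move=> x; have [k [l [[e e0 he] kl]]] := fg (2 * x - 1).
  exists k, l; split; last first.
    case: kl => [|kl]; [by left|right].
    by apply/dyadic_double; rewrite -(dyadicDr _ (dyadicN dyadic1)).
  exists (e / 2); first lra.
  move=> h he2; have [|E1 E2] := he (2 * h); first lra.
  have -> : 2 * (x + h) - 1 = 2 * x - 1 + 2 * h by ring.
  have -> : 2 * (x - h) - 1 = 2 * x - 1 - 2 * h by ring.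
  by rewrite E1 E2; split; field.
Qed.

Lemma f0_fun0 : f0_fun 0 = 0.
Proof. by rewrite /f0_fun ifT ?mulr0//; lra. Qed.

Lemma f0_fun1 : f0_fun 1 = 1.
Proof. by rewrite /f0_fun !ifF; [field|lra|lra]. Qed.

Lemma crit_f1 : PL2_crit f1_fun.
Proof.
apply: (@crit_glue _ id); [exact: dyadic12| |exact: crit_id|].
  have -> : 2 * (1 / 2) - 1 = 0 :> R by field.
  by rewrite f0_fun0 mul0r addr0.
exact/crit_rescale/crit_f0.
Qed.

Lemma f1_fun0 : f1_fun 0 = 0.
Proof. by rewrite /f1_fun ifT//; lra. Qed.

Lemma f1_fun1 : f1_fun 1 = 1.
Proof.
rewrite /f1_fun ifF; last lra.
have -> : 2 * 1 - 1 = 1 :> R by ring.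
by rewrite f0_fun1; field.
Qed.

Lemma sigmaE f (n : int) x : f 0 = 0 -> f 1 = 1 ->
  n%:~R <= x <= n%:~R + 1 -> sigma f x = n%:~R + f (x - n%:~R).
Proof.
move=> f0 f1 /andP[nx]; rewrite le_eqVlt => /orP[/eqP ->|xn]; last first.
  by rewrite /sigma (floor_def (m := n)) // nx intrD.
rewrite /sigma -[_ + 1](intrD _ n 1) intrKfloor subrr f0 intrD addr0.
by rewrite addrAC subrr add0r f1.
Qed.

Lemma crit_sigma f : f 0 = 0 -> f 1 = 1 -> PL2_crit f -> PL2_crit (sigma f).
Proof.
move=> f0 f1 [fi fs fd fg]; have fle := le_mono fi; have flt := leW_mono fle.
have fl x : (Num.floor x)%:~R <= x < (Num.floor x)%:~R + 1.
  by rewrite floor_le -[_ + 1](intrD _ _ 1) floorD1_gt.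
split.
- move=> x y xy.
  have [/andP[x0 x1] /andP[y0 y1]] := (fl x, fl y).
  have : (Num.floor x <= Num.floor y)%R by apply: le_floor; exact: ltW.
  rewrite le_eqVlt => /orP[/eqP E|E].
    by rewrite /sigma E ltrD2l; apply: fi; rewrite ltrD2r.
  rewrite /sigma.
  have : f (x - (Num.floor x)%:~R) < 1 by rewrite -[X in _ < X]f1 flt ltrBlDl.
  have : 0 <= f (y - (Num.floor y)%:~R) by rewrite -{1}f0 fle subr_ge0.
  have : (Num.floor x)%:~R + 1 <= (Num.floor y)%:~R :> R.
    by rewrite -[_ + 1](intrD _ _ 1) ler_int lezD1.
  lra.
- move=> y; have /andP[y0 y1] := fl y.
  have [x xy] := fs (y - (Num.floor y)%:~R); exists ((Num.floor y)%:~R + x).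
  have x0 : 0 <= x by rewrite -fle f0 xy; lra.
  have x1 : x < 1 by rewrite -flt f1 xy; lra.
  rewrite (sigmaE (n := Num.floor y))//; last lra.
  by rewrite [_ + x - _]addrAC subrr add0r xy addrC subrK.
- move=> x; rewrite /sigma addrC dyadicDr; last exact: dyadic_int.
  by rewrite fd dyadicDr//; exact/dyadicN/dyadic_int.
- move=> x; set n := Num.floor x; have /andP[n0 n1] := fl x.
  have [xn|xn] := eqVneq x n%:~R.
    have [k [l0 [[e e0 he] _]]] := fg 0; have [k0 [l [[d d0 hd] _]]] := fg 1.
    exists k, l; split; last by right; rewrite xn; exact: dyadic_int.
    exists (Num.min 1 (Num.min e d)); first by rewrite !lt_min ltr01 e0 d0.
    move=> h; rewrite !lt_min => /and4P[h0 h1 he' hd'].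
    have [|E _] := he h; first by rewrite h0.
    have [|_ D] := hd h; first by rewrite h0.
    have [xh0 xh1] : 0 <= h /\ h <= 1 by lra.
    have -> : sigma f x = n%:~R + f (x - n%:~R) by [].
    have -> : sigma f (x + h) = n%:~R + f (x + h - n%:~R).
      by apply: sigmaE => //; rewrite xn lerDl xh0 lerD2l.
    have -> : sigma f (x - h) = (n - 1)%:~R + f (x - h - (n - 1)%:~R).
      by apply: sigmaE => //; rewrite xn intrB; apply/andP; split; lra.
    rewrite xn intrB.
    have -> : n%:~R + h - n%:~R = 0 + h :> R by ring.
    have -> : n%:~R - h - (n%:~R - 1) = 1 - h :> R by ring.
    by rewrite subrr E D f0 f1; split; ring.
  have {}n0 : n%:~R < x by rewrite lt_neqAle eq_sym xn.
  have [k [l [[e e0 he] kl]]] := fg (x - n%:~R).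
  exists k, l; split; last first.
    case: kl => [|kl]; [by left|right].
    by rewrite -(dyadicDr _ (dyadicN (dyadic_int n))).
  exists (Num.min e (Num.min (x - n%:~R) (n%:~R + 1 - x))).
    by rewrite !lt_min e0; apply/andP; split; lra.
  move=> h; rewrite !lt_min => /and4P[h0 he' h1 h2].
  have [|E D] := he h; first by rewrite h0.
  have -> : sigma f x = n%:~R + f (x - n%:~R) by [].
  have -> : sigma f (x + h) = n%:~R + f (x + h - n%:~R).
    by apply: sigmaE => //; apply/andP; split; lra.
  have -> : sigma f (x - h) = n%:~R + f (x - h - n%:~R).
    by apply: sigmaE => //; apply/andP; split; lra.
  by rewrite [x + h - _]addrAC [x - h - _]addrAC E D; split; ring.
Qed.

Definition x0 : PL2 := toPL2 (is_PL2_crit crit_x0).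
Definition x1 : PL2 := toPL2 (is_PL2_crit crit_x1).
Definition w0 : PL2 :=
  toPL2 (is_PL2_crit (crit_sigma f0_fun0 f0_fun1 crit_f0)).
Definition w1 : PL2 :=
  toPL2 (is_PL2_crit (crit_sigma f1_fun0 f1_fun1 crit_f1)).

Lemma generatorsE : [/\ x0 = x0_fun :> (R -> R), x1 = x1_fun :> (R -> R),
  w0 = sigma f0_fun :> (R -> R) & w1 = sigma f1_fun :> (R -> R)].
Proof. by []. Qed.

Definition C_gens : set PL2 := [set x0; x1; w0; w1].
Definition Fx_gens : set PL2 := [set x0; x1].
Definition Fw_gens : set PL2 := [set w0; w1].

(* The maximum defining the distortion of F_x in C is attained. *)
Lemma distortion_FxP n :
  distortion_values C_gens Fx_gens n (distortion C_gens Fx_gens n) /\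
  forall k, distortion_values C_gens Fx_gens n k ->
    (k <= distortion C_gens Fx_gens n)%N.
Proof.
apply: distortionP; first by rewrite /C_gens !finite_setU; do !split.
by move=> y yx; apply: sub_gen_smallest; left; left; exact: yx.
Qed.

End PL2.

Arguments C_gens : clear implicits.
Arguments Fx_gens : clear implicits.
Arguments Fw_gens : clear implicits.

(* Main.v *)
(* For f in F, let a(f) in F_x be the copy of f supported on [0, 1], and b(f)
   its translate supported on [1, 2]. As x1 doubles [0, 1] onto [0, 2], the
   conjugate of x1 by v = sigma(f) is a(f) b(f) x1 a(f)^-1, so its F_x-length
   is linear in the F_w-length of v, while v commutes with x0. Moving all the
   letters w0, w1 of a word of length n in C to the right thus writes its value
   as p v, with p in F_x of length O(n^2) and v in F_w of length at most n.
   Since F_x and F_w intersect trivially, this bounds the distortion of F_x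
   and shows that F_w is undistorted.
   Conversely, an element of F_x of length l has at most 2l breakpoints, whereas
   the conjugate of x1^m by w0^m has a number of breakpoints quadratic in m:
   w0^m has about m of them in each of the m + 1 unit intervals that x1^m
   produces from [0, 1]. *)
Require Import Defs.
From HB Require Import structures.
From mathcomp Require Import all_boot all_order all_algebra.
From mathcomp Require Import all_classical all_reals all_analysis.
From mathcomp Require Import zify ring lra.
Import Order.TTheory GRing.Theory Num.Theory.
Import numFieldNormedType.Exports.
Local Open Scope ring_scope.

Set Implicit Arguments.
Unset Strict Implicit.
Unset Printing Implicit Defensive.

(** * Upper bounds on word length in an arbitrary group *)

Section WordLe.
Variable G : groupType.
Implicit Types (S : set G) (x y : G) (m n : nat).

(** An upper bound in place of the exact length: it passes through products and inverses without any
    appeal to minimality. *)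
Definition word_le S x n := exists2 m, (m <= n)%N & has_word S x m.

Lemma word_le_mono S x m n : (m <= n)%N -> word_le S x m -> word_le S x n.
Proof. by move=> mn [k km Sx]; exists k => //; exact: leq_trans mn. Qed.

Lemma word_le1 S n : word_le S 1%g n.
Proof. by exists 0%N => //; exists [::]; split=> //; rewrite big_nil. Qed.

Lemma word_le_gen S x : S x -> word_le S x 1.
Proof.
move=> Sx; exists 1%N => //; exists [:: x]; split; rewrite ?big_seq1 //.
by move=> y; rewrite inE => /eqP ->; left.
Qed.

Lemma word_leM S x y m n :
  word_le S x m -> word_le S y n -> word_le S (x * y)%g (m + n).
Proof.
move=> [k km [s [sk sS <-]]] [l ln [t [tl tS <-]]].
exists (k + l)%N; first exact: leq_add.
exists (s ++ t); split; [by rewrite size_cat sk tl| |by rewrite big_cat].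
by move=> z; rewrite mem_cat => /orP[/sS|/tS].
Qed.

Lemma word_leV S x n : word_le S x n -> word_le S x^-1%g n.
Proof.
move=> [k kn [s [sk sS <-]]]; exists k => //.
exists (rev [seq y^-1%g | y <- s]); split; first by rewrite size_rev size_map.
  by move=> z; rewrite mem_rev => /mapP[y /sS yS ->]; rewrite invgK or_comm.
by rewrite -map_rev big_map prodgV revK.
Qed.

Lemma word_leX S x n k : word_le S x n -> word_le S (x ^+ k)%g (k * n).
Proof.
move=> Sx; elim: k => [|k IH]; first exact: word_le1.
by rewrite expgS mulSn; exact: word_leM.
Qed.

(** Words grow on the right, so that in a product [p v y] each new letter [y] meets the [F_w] factor
    [v]. *)
Lemma has_word_ind S (P : G -> nat -> Prop) : P 1%g 0%N ->
  (forall x y n, P x n -> S y \/ S y^-1%g -> P (x * y)%g n.+1) ->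
  forall x n, has_word S x n -> P x n.
Proof.
move=> P1 PM x n [s [<- sS <-]]; elim/last_ind: s sS => [|s y IH] sS.
  by rewrite big_nil.
rewrite size_rcons -cats1 big_cat big_seq1; apply: PM.
  by apply: IH => z zs; apply: sS; rewrite mem_rcons inE zs orbT.
by apply: sS; rewrite mem_rcons mem_head.
Qed.

Lemma word_le_generated S x n : word_le S x n -> generated S x.
Proof. by move=> [m _ Sx]; apply/generatedP; exists m. Qed.

Lemma word_length_le S x n : word_le S x n -> (word_length S x <= n)%N.
Proof.
move=> Sx; have [_ h] := word_lengthP (word_le_generated Sx).
by have [m mn /h] := Sx => /leq_trans; apply.
Qed.

Lemma word_le_length S x :
  generated S x -> word_le S x (word_length S x).
Proof. by move=> /word_lengthP[Sx _]; exists (word_length S x). Qed.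

End WordLe.

(** * The action of [x0] and [x1] on the line *)

Section PL2Theory.
Variable R : realType.
Implicit Types (f g p v a : PL2 R) (u : R).

Lemma PL2_mulE f g u : (f * g)%g u = f (g u). Proof. by []. Qed.

Lemma PL2K f : cancel f f^-1%g.
Proof. by move=> u; rewrite -PL2_mulE mulVg. Qed.

Lemma PL2VK f : cancel f^-1%g f.
Proof. by move=> u; rewrite -PL2_mulE mulgV. Qed.

Lemma PL2_le f : {mono f : x y / x <= y}.
Proof. exact: le_mono (PL2_increasing (PL2P f)). Qed.

Lemma PL2_lt f : {mono f : x y / x < y}.
Proof. exact: leW_mono (PL2_le f). Qed.

Lemma PL2V_eq f u u' : f u' = u -> f^-1%g u = u'.
Proof. by move=> <-; rewrite PL2K. Qed.

Lemma x0E u : x0 R u = u + 1. Proof. by []. Qed.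

Lemma x0VE u : (x0 R)^-1%g u = u - 1.
Proof. by apply: PL2V_eq; rewrite x0E subrK. Qed.

Lemma x1_le0 u : u <= 0 -> x1 R u = u.
Proof. by move=> u0; rewrite /= /x1_fun u0. Qed.

Lemma x1_unit u : 0 <= u <= 1 -> x1 R u = 2 * u.
Proof.
move=> /andP[u0 u1]; rewrite /= /x1_fun u1; case: ifP => // u0'.
by rewrite (_ : u = 0) ?mulr0//; lra.
Qed.

Lemma x1_ge1 u : 1 <= u -> x1 R u = u + 1.
Proof.
move=> u1; rewrite /= /x1_fun ifF; last by apply/negbTE; lra.
by case: ifP => // u1'; lra.
Qed.

(** * Copies of elements of [F_w] supported on the unit interval *)

(* [a] is [v] restricted to [0, 1]; for v ranging over F_w this is the
   embedding of F into F_x as the subgroup supported on [0, 1]. *)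
Definition unit_copy v a : Prop :=
  [/\ (forall u, v (u + 1) = v u + 1), v 0 = 0,
      (forall u, 0 <= u <= 1 -> a u = v u),
      (forall u, u <= 0 -> a u = u) & (forall u, 1 <= u -> a u = u)].

Lemma unit_copy1 : unit_copy 1%g 1%g.
Proof. by split. Qed.

Lemma unit_copy_unit v a u : unit_copy v a -> (0 <= v u <= 1) = (0 <= u <= 1).
Proof.
move=> [v1 v0 _ _ _]; have v11 : v 1 = 1 by have := v1 0; rewrite v0 !add0r.
by rewrite -{1}v0 -{1}v11 !PL2_le.
Qed.

Lemma unit_copyM v a v' a' :
  unit_copy v a -> unit_copy v' a' -> unit_copy (v * v')%g (a * a')%g.
Proof.
move=> ca ca'; have [v1 v0 av a0 a1] := ca; have [v1' v0' av' a0' a1'] := ca'.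
split=> [u||u u01|u u0|u u1]; rewrite !PL2_mulE.
- by rewrite v1' v1.
- by rewrite v0' v0.
- by rewrite av'// av// (unit_copy_unit _ ca').
- by rewrite a0'// a0.
- by rewrite a1'// a1.
Qed.

Lemma unit_copyV v a : unit_copy v a -> unit_copy v^-1%g a^-1%g.
Proof.
move=> ca; have [v1 v0 av a0 a1] := ca.
split=> [u||u u01|u u0|u u1]; apply: PL2V_eq.
- by rewrite v1 PL2VK.
- exact: v0.
- by rewrite av ?PL2VK// -(unit_copy_unit _ ca) PL2VK.
- exact: a0.
- exact: a1.
Qed.

(* Both sides are the identity on negative reals and the unit translation
   beyond 1; on [0, 1], x1 doubles onto [0, 2], where v is a copy of
   itself on each of the two halves. *)
Lemma conj_x1 v a : unit_copy v a ->
  (v * x1 R * v^-1 = a * (x0 R * a * (x0 R)^-1) * x1 R * a^-1)%g.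
Proof.
move=> ca; have [v1 v0 av a0 a1] := ca.
apply: (mulIg a); rewrite mulgVK; apply: PL2_eq => u.
rewrite !PL2_mulE x0VE x0E.
have v11 : v 1 = 1 by have := v1 0; rewrite v0 !add0r.
have [u0|u0] := lerP u 0.
  have vu : v^-1%g u <= 0 by rewrite -(PL2_le v) PL2VK v0.
  by rewrite a0// !x1_le0// PL2VK a0 ?subrK ?a0//; lra.
have [u1|u1] := lerP 1 u.
  have vu : 1 <= v^-1%g u by rewrite -(PL2_le v) PL2VK v11.
  by rewrite a1// !x1_ge1// v1 PL2VK addrK a1 // a1//; lra.
rewrite av; last lra.
rewrite PL2K !x1_unit; last lra.
have [u2|u2] := lerP (2 * u) 1.
  by rewrite [X in a (X + 1)]a0 ?subrK ?av//; lra.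
rewrite (av (2 * u - 1)); last lra.
by rewrite -v1 subrK a1// -[leLHS]v11 PL2_le; lra.
Qed.

(** This is [(x0 x1 x0^-1 x1)^-1 x1^2]. The map [x1^2] sends the pieces [0,1/4], [1/4,1/2], [1/2,1]
    of [f0_fun] affinely onto [0,1], [1,2], [2,3], and [x0 x1 x0^-1 x1] sends their images [0,1/2],
    [1/2,3/4], [3/4,1] affinely onto the same unit intervals. *)
Definition unit_w0 : PL2 R :=
  ((x1 R)^-1 * x0 R * (x1 R)^-1 * (x0 R)^-1 * x1 R * x1 R)%g.

(** Conjugation by [x0] moves the copy to [1,2]; then [x1^-1] shrinks it to [1/2,1]. *)
Definition unit_w1 : PL2 R :=
  ((x1 R)^-1 * (x0 R * unit_w0 * (x0 R)^-1) * x1 R)%g.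

Lemma w0_unit u : 0 <= u <= 1 -> w0 R u = f0_fun u.
Proof.
move=> u01; rewrite [LHS](@sigmaE _ _ 0) ?subr0 ?add0r//.
  exact: f0_fun0.
exact: f0_fun1.
Qed.

Lemma w1_unit u : 0 <= u <= 1 -> w1 R u = f1_fun u.
Proof.
move=> u01; rewrite [LHS](@sigmaE _ _ 0) ?subr0 ?add0r//.
  exact: f1_fun0.
exact: f1_fun1.
Qed.

Lemma sigma_periodic (h : R -> R) u : sigma h (u + 1) = sigma h u + 1.
Proof.
have -> : sigma h (u + 1) =
    (Num.floor u + 1)%:~R + h (u + 1 - (Num.floor u + 1)%:~R).
  by rewrite /sigma floorDrz ?int_num1// floor1.
rewrite /sigma intrD (_ : u + 1 - _ = u - (Num.floor u)%:~R); last by ring.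
by rewrite addrAC.
Qed.

Lemma unit_w0P u u' : x1 R (x1 R u' - 1) + 1 = x1 R (x1 R u) -> unit_w0 u = u'.
Proof.
by move=> e; rewrite !PL2_mulE -e x0VE addrK PL2K x0E subrK PL2K.
Qed.

Lemma unit_w0_copy : unit_copy (w0 R) unit_w0.
Proof.
split.
- exact: sigma_periodic.
- by rewrite w0_unit ?f0_fun0//; lra.
- move=> u u01; rewrite w0_unit//; apply: unit_w0P; rewrite (x1_unit u01).
  rewrite /f0_fun; case: ifP => u4.
    by rewrite (@x1_unit (2 * u)) ?x1_le0; lra.
  case: ifP => u2.
    by rewrite (@x1_unit (u + _)) ?x1_unit; lra.
  rewrite (@x1_unit ((u + 1) / 2)); last lra.
  by rewrite (@x1_unit (_ - 1)) ?x1_ge1; lra.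
- move=> u u0; apply: unit_w0P; rewrite !(x1_le0 u0) x1_le0; lra.
- by move=> u u1; apply: unit_w0P; rewrite !(x1_ge1 u1) addrK !x1_ge1; lra.
Qed.

Lemma unit_w1_copy : unit_copy (w1 R) unit_w1.
Proof.
have [_ _ a01 a0 a1] := unit_w0_copy.
have aP u u' : unit_w0 (x1 R u - 1) + 1 = x1 R u' -> unit_w1 u = u'.
  move=> e; apply: PL2V_eq; rewrite -e -x0VE //.
split.
- exact: sigma_periodic.
- by rewrite w1_unit ?f1_fun0//; lra.
- move=> u u01; rewrite w1_unit//; apply: aP; rewrite (x1_unit u01).
  rewrite /f1_fun; case: ifP => u2.
    by rewrite a0 ?x1_unit; lra.
  rewrite a01; last lra.
  rewrite w0_unit; last lra.
  have : 0 <= f0_fun (2 * u - 1) <= 1.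
    by rewrite -w0_unit ?(unit_copy_unit _ unit_w0_copy); lra.
  by move=> h; rewrite x1_unit; lra.
- by move=> u u0; apply: aP; rewrite !(x1_le0 u0) a0; lra.
- by move=> u u1; apply: aP; rewrite !(x1_ge1 u1) a1; lra.
Qed.

(** * Lengths in [F_x] of these copies and of the conjugates of [x1] *)

Lemma word_le_x0 : word_le (Fx_gens R) (x0 R) 1.
Proof. by apply: word_le_gen; left. Qed.

Lemma word_le_x1 : word_le (Fx_gens R) (x1 R) 1.
Proof. by apply: word_le_gen; right. Qed.

Lemma word_le_unit_w0 : word_le (Fx_gens R) unit_w0 6.
Proof.
have [h0 h1] := (word_le_x0, word_le_x1).
apply: (@word_leM _ _ _ _ 5 1) => //; apply: (@word_leM _ _ _ _ 4 1) => //.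
apply: (@word_leM _ _ _ _ 3 1); last exact: word_leV.
apply: (@word_leM _ _ _ _ 2 1); last exact: word_leV.
by apply: (@word_leM _ _ _ _ 1 1) => //; exact: word_leV.
Qed.

Lemma word_le_unit_w1 : word_le (Fx_gens R) unit_w1 10.
Proof.
have [h0 h1] := (word_le_x0, word_le_x1).
apply: (@word_leM _ _ _ _ 9 1) => //; apply: (@word_leM _ _ _ _ 1 8); first exact: word_leV.
apply: (@word_leM _ _ _ _ 7 1); last exact: word_leV.
exact: (@word_leM _ _ _ _ 1 6) word_le_unit_w0.
Qed.

(** Copies multiply and invert along with the letters; the factor 10 is the larger of the bounds 6
    and 10 for the copies of [w0] and [w1]. *)
Lemma unit_copy_word v n : word_le (Fw_gens R) v n ->
  exists2 a, unit_copy v a & word_le (Fx_gens R) a (10 * n).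
Proof.
move=> [m mn vm].
suff [a va am] : exists2 a, unit_copy v a & word_le (Fx_gens R) a (10 * m).
  by exists a => //; apply: word_le_mono am; rewrite leq_mul2l.
elim/has_word_ind: v m / vm {mn} => [|v y m [a va am] yP].
  by exists 1%g; [exact: unit_copy1|exact: word_le1].
suff [b yb b10] : exists2 b, unit_copy y b & word_le (Fx_gens R) b 10.
  exists (a * b)%g; first exact: unit_copyM.
  by rewrite mulnS addnC; exact: word_leM.
have [h0 h1] := (word_le_mono (isT : (6 <= 10)%N) word_le_unit_w0, word_le_unit_w1).
have [c0 c1] := (unit_w0_copy, unit_w1_copy).
have gens z : Fw_gens R z -> exists2 b, unit_copy z b & word_le (Fx_gens R) b 10.
  by move=> [] ->; [exists unit_w0|exists unit_w1].
case: yP => [/gens//|/gens[b yb bn]]; exists b^-1%g; last exact: word_leV.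
by rewrite -[y]invgK; exact: unit_copyV.
Qed.

(** In [conj_x1] the copy [a] or its inverse occurs three times, beside the three letters [x0],
    [x0^-1], [x1]. *)
Lemma word_le_conj_x1 v n : word_le (Fw_gens R) v n ->
  word_le (Fx_gens R) (v * x1 R * v^-1)%g (30 * n + 3).
Proof.
move=> /unit_copy_word[a /conj_x1 -> an].
have -> : (30 * n + 3 = 10 * n + (1 + 10 * n + 1) + 1 + 10 * n)%N by lia.
have [h0 h1] := (word_le_x0, word_le_x1).
by do ![apply: word_leM => //|exact: word_leV].
Qed.

(** * Factorization of [C] and triviality of the intersection *)

Lemma C_decomposition x n : word_le (C_gens R) x n -> exists p v,
  [/\ word_le (Fx_gens R) p (33 * n ^ 2), word_le (Fw_gens R) v n & x = (p * v)%g].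
Proof.
move=> [m mn xm].
suff [p [v [pm vm ->]]] : exists p v, [/\ word_le (Fx_gens R) p (33 * m ^ 2),
    word_le (Fw_gens R) v m & x = (p * v)%g].
  exists p, v; split; [apply: word_le_mono pm|exact: word_le_mono vm|by []].
  by rewrite leq_mul2l leq_exp2r.
elim/has_word_ind: x m / xm {mn} => [|x y m [p [v [pm vm ->]]] yP].
  by exists 1%g, 1%g; rewrite mulg1; split; [exact: word_le1|exact: word_le1|].
have [wy|[q [vy q3]]] : word_le (Fw_gens R) y 1 \/
    exists q, (v * y = q * v)%g /\ word_le (Fx_gens R) q (30 * m + 3).
- have gens z : C_gens R z -> word_le (Fw_gens R) z 1 \/
      exists q, (v * z = q * v)%g /\ word_le (Fx_gens R) q (30 * m + 3).
    move=> [[[->|->]|->]|->].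
    + right; exists (x0 R); split; last first.
        by apply: word_le_mono word_le_x0; lia.
      have [a [v1 _ _ _ _] _] := unit_copy_word vm.
      by apply: PL2_eq => u; exact: v1.
    + right; exists (v * x1 R * v^-1)%g; split; first by rewrite mulgVK.
      exact: word_le_conj_x1.
    + by left; apply: word_le_gen; left.
    + by left; apply: word_le_gen; right.
  case: yP => [/gens//|/gens[/word_leV|[q [e qn]]]]; first by rewrite invgK; left.
  (* From [v y^-1 = q v] follows [v y = q^-1 v]. *)
  right; exists q^-1%g; split; last exact: word_leV.
  by apply: (mulgI q); rewrite mulgA mulVKg -e mulgVK.
- exists p, (v * y)%g; split; last by rewrite mulgA.
    by apply: word_le_mono pm; rewrite leq_mul2l leq_exp2r// leqnSn.
  by rewrite -addn1; exact: word_leM.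
- exists (p * q)%g, v; split; last by rewrite -!mulgA vy.
    (* Here [33 m^2 + 30 m + 3 <= 33 (m + 1)^2]. *)
    by apply: word_le_mono (word_leM pm q3); nia.
  exact: word_le_mono vm.
Qed.

Lemma Fx_eventually_translation f : generated (Fx_gens R) f ->
  exists (k : int) (M : R), forall u, M <= u -> f u = u + k%:~R.
Proof.
move=> /generatedP[n fn].
elim/has_word_ind: f n / fn => [|f g n [k [M fP]] gP].
  by exists 0, 0 => u _; rewrite addr0.
suff [l [N gN]] : exists (l : int) (N : R), forall u, N <= u -> g u = u + l%:~R.
  exists (k + l), (Num.max N (M - l%:~R)) => u; rewrite ge_max => /andP[uN uM].
  by rewrite PL2_mulE gN// fP ?intrD; [ring|lra].
case: gP => [[]|[]/(canRL invgK)] ->.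
- by exists 1, 0 => u _; rewrite x0E.
- by exists 1, 1 => u u1; rewrite x1_ge1.
- by exists (- 1), 0 => u _; rewrite x0VE intrN.
(* The threshold is 2 because [x1] sends the half-line from 1 to the half-line from 2. *)
- exists (- 1), 2 => u u2; apply: PL2V_eq; rewrite x1_ge1 intrN ?subrK//; lra.
Qed.

(** Elements of [F_w] fix 0 and commute with the unit translation, hence fix all natural numbers. If
    such a map is a translation near plus infinity, its shift is 0, and periodicity carries the
    identity back to every point. *)
Lemma Fx_Fw_trivial f :
  generated (Fx_gens R) f -> generated (Fw_gens R) f -> f = 1%g.
Proof.
move=> /Fx_eventually_translation[k [M fM]] /word_le_length/unit_copy_word.
move=> [a [f1 f0 _ _ _] _].
have fn u n : f (u + n%:R) = f u + n%:R.
  elim: n => [|n IH]; first by rewrite !addr0.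
  by rewrite mulrSr !addrA f1 IH.
have large u : exists n : nat, M <= u + n%:R.
  have /archi_boundP h : 0 <= `|M - u| by [].
  exists (Num.bound `|M - u|); have := ler_norm (M - u); lra.
have k0 : k%:~R = 0 :> R.
  have [n nM] := large 0; have := fn 0 n; rewrite fM// f0; lra.
apply: PL2_eq => u; have [n nM] := large u.
by have := fn u n; rewrite fM// k0 addr0 => /addIr.
Qed.

(** The [F_w] factor equals [p^-1 f], so it lies in both subgroups and is trivial; only the [F_x]
    factor of quadratic length remains. *)
Lemma Fx_length_le f n : generated (Fx_gens R) f -> word_le (C_gens R) f n ->
  word_le (Fx_gens R) f (33 * n ^ 2).
Proof.
move=> fx /C_decomposition[p [v [pn vn e]]].
suff v1 : v = 1%g by rewrite e v1 mulg1.
apply: Fx_Fw_trivial (word_le_generated vn).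
have -> : v = (p^-1 * f)%g by rewrite e mulKg.
apply: word_le_generated.
exact: word_leM (word_leV pn) (word_le_length fx).
Qed.

Lemma Fw_length_le f n : generated (Fw_gens R) f -> word_le (C_gens R) f n ->
  word_le (Fw_gens R) f n.
Proof.
move=> fw /C_decomposition[p [v [pn vn e]]].
suff p1 : p = 1%g by rewrite e p1 mul1g.
apply: (Fx_Fw_trivial (word_le_generated pn)).
have -> : p = (f * v^-1)%g by rewrite e mulgK.
apply: word_le_generated.
exact: word_leM (word_le_length fw) (word_leV vn).
Qed.

(** * Counting breakpoints *)

Lemma breakpoints_comp f g u :
  ~ breakpoints g u -> ~ breakpoints f (g u) -> ~ breakpoints (f * g)%g u.
Proof.
have [g' [gc _ _ _]] := PL2_homeo (PL2P g).
move=> /contrapT[c [d gcd]] /contrapT[a [b fab]] B; apply: B.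
by exists (a * c), (a * d + b); exact: (affine_near_comp (gc u) fab gcd).
Qed.

Lemma breakpoints_inv f u : ~ breakpoints f (f^-1%g u) -> ~ breakpoints f^-1%g u.
Proof.
have [f' [f'c _ _ _]] := PL2_homeo (PL2P f^-1%g).
move=> /contrapT[a [b fab]] B; apply: B; exists a^-1, (- (a^-1 * b)).
apply: (affine_near_inv _ (PL2VK f) (f'c u) fab).
exact: affine_near_neq0 (PL2_increasing (PL2P f)) fab.
Qed.

Lemma breakpoints_near (f g : R -> R) u :
  (\forall y \near u, f y = g y) -> breakpoints f u -> breakpoints g u.
Proof.
move=> fg Bf [a [b gab]]; apply: Bf; exists a, b; rewrite /affine_near.
by near=> y; rewrite (near fg y)// (near gab y).
Unshelve. all: by end_near. Qed.

Lemma breakpoints_itv (f : R -> R) (l r u a b : R) : l < u < r ->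
  (forall y, l < y < r -> f y = a * y + b) -> ~ breakpoints f u.
Proof.
move=> lur fab; apply; exists a, b; rewrite /affine_near.
have ulr : u \in `]l, r[ by rewrite in_itv.
near=> y; apply: fab.
by have : y \in `]l, r[ by near: y; exact: near_in_itvoo.
Unshelve. all: by end_near. Qed.

Definition breakpoints_le f n := exists2 s : seq R,
  (size s <= n)%N & forall u, breakpoints f u -> u \in s.

(** A breakpoint of [f g] is one of [g] or the [g]-preimage of one of [f]. *)
Lemma breakpoints_leM f g m n : breakpoints_le f m -> breakpoints_le g n ->
  breakpoints_le (f * g)%g (m + n).
Proof.
move=> [s sm fs] [t tn gt].
exists ([seq g^-1%g y | y <- s] ++ t).
  by rewrite size_cat size_map leq_add.
move=> u Bu; rewrite mem_cat.
have [/gt -> | ng] := pselect (breakpoints g u); first by rewrite orbT.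
have [/fs gus | nf] := pselect (breakpoints f (g u)).
  by apply/orP; left; apply/mapP; exists (g u); rewrite ?PL2K.
by case: (breakpoints_comp ng nf).
Qed.

Lemma breakpoints_leV f n : breakpoints_le f n -> breakpoints_le f^-1%g n.
Proof.
move=> [s sn fs]; exists [seq f y | y <- s]; first by rewrite size_map.
move=> u Bu; apply/mapP; exists (f^-1%g u); last by rewrite PL2VK.
by apply: fs; apply: contrapT => /breakpoints_inv; exact.
Qed.

Lemma breakpoints_x0 u : ~ breakpoints (x0 R) u.
Proof.
apply: (@breakpoints_itv _ (u - 1) (u + 1) _ 1 1); first lra.
by move=> y _; rewrite x0E mul1r.
Qed.

Lemma breakpoints_x1 : breakpoints_le (x1 R) 2.
Proof.
exists [:: 0; 1] => // u; apply: contraPT.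
rewrite !inE negb_or => /andP[u0 u1].
have [u0'|u0'|/eqP] := ltgtP u 0; last by rewrite (negbTE u0).
  apply: (@breakpoints_itv _ (u - 1) 0 _ 1 0); first lra.
  by move=> y yu; rewrite x1_le0; lra.
have [u1'|u1'|/eqP] := ltgtP u 1; last by rewrite (negbTE u1).
  apply: (@breakpoints_itv _ 0 1 _ 2 0); first lra.
  by move=> y yu; rewrite x1_unit; lra.
apply: (@breakpoints_itv _ 1 (u + 1) _ 1 1); first lra.
by move=> y yu; rewrite x1_ge1; lra.
Qed.

Lemma word_le_breakpoints f n :
  word_le (Fx_gens R) f n -> breakpoints_le f (2 * n).
Proof.
move=> [m mn fm].
suff [s sm fs] : breakpoints_le f (2 * m).
  by exists s => //; apply: leq_trans sm _; rewrite leq_mul2l.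
elim/has_word_ind: f m / fm {mn} => [|f g m fm gP].
  by exists [::] => // u; case; exists 1, 0; near=> y; rewrite mul1r addr0.
have gens h : Fx_gens R h -> breakpoints_le h 2.
  by move=> [] ->; [exists [::] => // u /breakpoints_x0|exact: breakpoints_x1].
rewrite mulnS addnC; apply: breakpoints_leM => //.
by case: gP => [/gens//|/gens/breakpoints_leV]; rewrite invgK.
Unshelve. all: by end_near. Qed.

(** * Breakpoints of the powers of [w0] *)

Lemma w0_double u : 0 <= u <= 1 / 4 -> w0 R u = 2 * u.
Proof. by move=> u4; rewrite w0_unit /f0_fun ?ifT//; lra. Qed.

Lemma w0_shift u : 1 / 4 <= u <= 1 / 2 -> w0 R u = u + 1 / 4.
Proof.
move=> u4; have [u4'|u4'] := lerP u (1 / 4).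
  by rewrite w0_double; lra.
by rewrite w0_unit /f0_fun 1?ifF ?ifT//; lra.
Qed.

Lemma w0_halve u : 1 / 2 <= u <= 1 -> w0 R u = (u + 1) / 2.
Proof.
move=> u2; have [u2'|u2'] := lerP u (1 / 2).
  by rewrite w0_shift; lra.
by rewrite w0_unit /f0_fun ?ifF//; lra.
Qed.

Lemma quarter_div_exp_bounds i : 0 < (4^-1 / 2 ^+ i : R) <= 1 / 4.
Proof.
have i0 : 0 < 2 ^+ i :> R by rewrite exprn_gt0.
have i1 : 1 <= 2 ^+ i :> R by rewrite exprn_ege1//; lra.
by rewrite divr_gt0//= ler_pdivrMr//; nra.
Qed.

(** The orbit climbs to 1/4 by doubling, and [w0] is only ever applied at points strictly inside the
    doubling piece. *)
Lemma w0X_quarter i : (w0 R ^+ i)%g (4^-1 / 2 ^+ i) = 4^-1 /\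
  ~ breakpoints (w0 R ^+ i)%g (4^-1 / 2 ^+ i).
Proof.
elim: i => [|i [IH1 IH2]].
  rewrite expr0 divr1; split=> //.
  by apply: (@breakpoints_itv _ 0 1 _ 1 0) => [|y _]; [lra|rewrite mul1r addr0].
set t := 4^-1 / 2 ^+ i in IH1 IH2 *.
have -> : 4^-1 / 2 ^+ i.+1 = t / 2 :> R by rewrite exprSr invfM mulrA.
have t01 : 0 < t <= 1 / 4 := quarter_div_exp_bounds i.
have wt : w0 R (t / 2) = t by rewrite w0_double; lra.
rewrite expgSr PL2_mulE wt; split=> //.
apply: breakpoints_comp; last by rewrite wt.
apply: (@breakpoints_itv _ 0 (1 / 4) _ 2 0); first lra.
by move=> y yu; rewrite w0_double; lra.
Qed.

(** The orbit never leaves the open interval from 1/2 to 1, where [w0] is affine. *)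
Lemma breakpoints_w0X_near1 r t : 0 < t < 1 / 2 ->
  ~ breakpoints (w0 R ^+ r)%g (1 - t).
Proof.
elim: r t => [|r IH] t t2.
  by apply: (@breakpoints_itv _ 0 1 _ 1 0) => [|y _]; [lra|rewrite mul1r addr0].
rewrite expgSr; apply: breakpoints_comp.
  apply: (@breakpoints_itv _ (1 / 2) 1 _ (1 / 2) (1 / 2)); first lra.
  by move=> y yu; rewrite w0_halve; lra.
rewrite w0_halve; last lra.
have -> : (1 - t + 1) / 2 = 1 - t / 2 by field.
by apply: IH; lra.
Qed.

(* The breakpoints 1/4 and 1/2 of w0 lie in one orbit, but do not cancel:
   the slopes of the square at 1/4 are 2 on the left and 1/2 on the right. *)
Lemma breakpoints_w0_sqr : breakpoints (w0 R * w0 R)%g 4^-1.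
Proof.
move=> [a [b /nbhs_ballP[e /= e0 he]]].
(* With [h < 1/8], [w0] sends 1/4 - h into [1/4,1/2] and 1/4 + h into [1/2,1], so the second
   application is affine and explicit on each side. *)
pose h := Num.min e (1 / 8) / 2.
have m0 : 0 < Num.min e (1 / 8) by rewrite lt_min e0; lra.
have [me m8] : Num.min e (1 / 8) <= e /\ Num.min e (1 / 8) <= 1 / 8.
  by rewrite !ge_min !lexx orbT.
have hh : [/\ 0 < h, h < e & h < 1 / 8] by split; rewrite /h; lra.
move: h hh {m0 me m8} => h [h0 hhe h8].
have bl y : - h <= y <= h -> ball (4^-1 : R) e (4^-1 + y).
  move=> yh; rewrite /ball /= opprD addrA subrr sub0r normrN ltr_norml.
  by apply/andP; split; lra.
have val y : - h <= y <= h -> w0 R (w0 R (4^-1 + y)) = a * (4^-1 + y) + b.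
  by move=> /bl/he.
have := val 0; have := val h; have := val (- h).
rewrite (@w0_double (4^-1 - h)); last lra.
rewrite (@w0_shift (4^-1 + h)) ?(@w0_shift (4^-1 + 0)); try lra.
by rewrite (@w0_shift (2 * _)) ?(@w0_halve (_ + _)); lra.
Qed.

(** In [w0^m = w0^r w0^2 w0^i] the right factor is affine near the point and sends it to 1/4, the
    middle one breaks there, and the left one is affine near the image 3/4. Affineness of the whole
    would therefore pass to [w0^2]. *)
Lemma breakpoints_w0X m i : (i + 2 <= m)%N ->
  breakpoints (w0 R ^+ m)%g (4^-1 / 2 ^+ i).
Proof.
move=> im; set q := _ / _; set W := (w0 R ^+ m)%g; apply: contrapT => nW.
have [wq nq] := w0X_quarter i; rewrite -/q in wq nq.
pose r := (m - (i + 2))%N.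
have WE : W = (w0 R ^+ r * (w0 R * w0 R) * w0 R ^+ i)%g.
  by rewrite -expg2 -!expgnDr /W; congr (_ ^+ _)%g; rewrite /r; lia.
have e : (w0 R * w0 R = (w0 R ^+ r)^-1 * (W * (w0 R ^+ i)^-1))%g.
  by rewrite WE mulgK mulKg.
apply: (@breakpoints_comp (w0 R ^+ r)^-1 (W * (w0 R ^+ i)^-1) 4^-1)%g; last first.
- by rewrite -e; exact: breakpoints_w0_sqr.
- apply: breakpoints_inv; rewrite -PL2_mulE -e.
  have -> : (w0 R * w0 R)%g 4^-1 = 1 - 1 / 4.
    by rewrite PL2_mulE (@w0_shift 4^-1) ?w0_halve; lra.
  by apply: breakpoints_w0X_near1; lra.
have qE : (w0 R ^+ i)^-1%g 4^-1 = q by exact: PL2V_eq.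
by apply: breakpoints_comp; [apply: breakpoints_inv|]; rewrite qE.
Qed.

Lemma breakpoints_periodic f u n : (f * x0 R = x0 R * f)%g ->
  breakpoints f u -> breakpoints f (u + n%:R).
Proof.
move=> fx Bu; elim: n => [|n IH]; first by rewrite addr0.
apply: contrapT => nB; suff: ~ breakpoints f (u + n%:R) by [].
have -> : f = ((x0 R)^-1 * (f * x0 R))%g by rewrite fx mulKg.
apply: breakpoints_comp; last by apply: breakpoints_inv; exact: breakpoints_x0.
apply: breakpoints_comp; first exact: breakpoints_x0.
by rewrite x0E -addrA -mulrSr.
Qed.

Lemma unit_copy_breakpoints v a u : unit_copy v a -> 0 < u < 1 ->
  breakpoints v u -> breakpoints a u.
Proof.
move=> [_ _ av _ _] u01; apply: breakpoints_near.
have ui : u \in `]0, 1[ by rewrite in_itv.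
near=> y; apply/esym/av.
have : y \in `]0, 1[ by near: y; exact: near_in_itvoo.
by rewrite in_itv /=; lra.
Unshelve. all: by end_near. Qed.

(** * Breakpoints of the conjugate of [x1^m] by [w0^m] *)

Lemma x1X_unit m : (x1 R ^+ m)%g 0 = 0 /\ (x1 R ^+ m)%g 1 = m.+1%:R.
Proof.
elim: m => [|m [h0 h1]] //; rewrite expgS !PL2_mulE h0 h1 x1_le0//; split=> //.
by rewrite x1_ge1 ?ler1n// -[RHS]natr1.
Qed.

(** Breakpoints of [w0^m] inside (0,m), a part of the image of [0,1] under [x1^m]. *)
Definition grid m : seq R :=
  [seq 4^-1 / 2 ^+ i + j%:R | i <- iota 0 m.-1, j <- iota 0 m].

Lemma grid_uniq m : uniq (grid m).
Proof.
apply: allpairs_uniq; [exact: iota_uniq|exact: iota_uniq|].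
have sep i j i' j' : (j < j')%N ->
    4^-1 / 2 ^+ i + j%:R <> 4^-1 / 2 ^+ i' + j'%:R :> R.
  move=> jj; have := quarter_div_exp_bounds i; have := quarter_div_exp_bounds i'.
  have : j%:R + 1 <= j'%:R :> R by rewrite natr1 ler_nat.
  lra.
move=> [i j] [i' j'] _ _ /= e.
have [/sep/(_ e)//|/sep/(_ (esym e))//|jj] := ltngtP j j'.
have q0 : 4^-1 != 0 :> R by rewrite invr_eq0 pnatr_eq0.
move: e; rewrite jj => /addIr/(mulfI q0)/invr_inj e; congr (_, _).
by apply: (ieexprIn _ _ e); rewrite ?ltr0n ?(eqr_nat _ 2 1).
Qed.

Lemma conj_x1X_breakpoints m n :
  breakpoints_le (w0 R ^+ m * x1 R ^+ m * (w0 R ^+ m)^-1)%g n ->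
  (m * m.-1 <= 22 * m + n)%N.
Proof.
set w := (w0 R ^+ m)%g; set x := (x1 R ^+ m)%g; set c := (_ * _)%g => -[sc nsc cP].
have wm : word_le (Fw_gens R) w (m * 1).
  by apply: word_leX; apply: word_le_gen; left.
(* The periodic map [w] is replaced by its copy [a], which has at most 20m breakpoints, to control
   those of [w] inside (0,1). *)
have [a wa /word_le_breakpoints[sa nsa aP]] := unit_copy_word wm.
have [sx nsx xP] := breakpoints_leV (word_le_breakpoints (word_leX m word_le_x1)).
have wx0 : (w * x0 R = x0 R * w)%g.
  by apply: PL2_eq => u; have [w1 _ _ _ _] := wa; exact: w1.
have [x0' x1'] := x1X_unit m; rewrite -/x in x0' x1'.
(* Since [w = c w x^-1], a breakpoint of [w] at [y] comes from [x^-1] at [y], from [w] at [x^-1 y],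
   or from [c] at [w x^-1 y]. The three lists have sizes at most 2m, 20m and n. *)
pose s := sx ++ [seq x y | y <- sa] ++ [seq x (w^-1%g y) | y <- sc].
have sub y : y \in grid m -> y \in s.
  case/allpairsP=> -[i j] /= []; rewrite !mem_iota => im jm ->.
  set q := 4^-1 / 2 ^+ i; set y' := q + _.
  have q01 : 0 < q <= 1 / 4 := quarter_div_exp_bounds i.
  have By : breakpoints w y'.
    by apply: breakpoints_periodic => //; apply: breakpoints_w0X; move: im; lia.
  have z01 : 0 < x^-1%g y' < 1.
    rewrite -[0 < _](PL2_lt x) -[_ < 1](PL2_lt x) PL2VK x0' x1' /y'.
    have : j%:R + 1 <= m%:R :> R by rewrite natr1 ler_nat; move: jm; lia.
    have := ler0n R j; rewrite -natr1; lra.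
  rewrite !mem_cat.
  have [/xP -> //|nx] := pselect (breakpoints x^-1%g y').
  have [/(unit_copy_breakpoints wa z01)/aP ya|nw] :=
      pselect (breakpoints w (x^-1%g y')).
    by rewrite (_ : y' \in map _ _) ?orbT//; apply/mapP; exists (x^-1%g y'); rewrite ?PL2VK.
  have [/cP yc|nc] := pselect (breakpoints c ((w * x^-1)%g y')).
    rewrite orbA orbC; apply/orP; left; apply/mapP.
    by exists ((w * x^-1)%g y') => //; rewrite PL2_mulE PL2K PL2VK.
  have := breakpoints_comp (breakpoints_comp nx nw) nc.
  by rewrite /c -!mulgA mulKg mulgV mulg1.
have := uniq_leq_size (grid_uniq m) sub.
rewrite size_allpairs !size_iota !size_cat !size_map mulnC => /leq_trans; apply.
have -> : (22 * m + n = 2 * (m * 1) + (2 * (10 * (m * 1)) + n))%N by lia.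
by rewrite !leq_add.
Qed.

(** * Bounds on the distortion function *)

Lemma Fx_word_le_C f n : word_le (Fx_gens R) f n -> word_le (C_gens R) f n.
Proof.
move=> [m mn [s [sm sS sf]]]; exists m => //; exists s; split=> // y /sS.
by case=> ?; [left|right]; left; left.
Qed.

Lemma distortion_quadratic_ub n :
  (distortion (C_gens R) (Fx_gens R) n <= 33 * n ^ 2)%N.
Proof.
have [[f [fx fn <-]] _] := @distortion_FxP R n.
have fC := word_le_generated (Fx_word_le_C (word_le_length fx)).
apply: word_length_le; apply: Fx_length_le => //.
exact: word_le_mono fn (word_le_length fC).
Qed.

Lemma distortion_ge f l n : word_le (Fx_gens R) f l -> word_le (C_gens R) f n ->
  (word_length (Fx_gens R) f <= distortion (C_gens R) (Fx_gens R) n)%N.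
Proof.
move=> fx fC; have [_] := @distortion_FxP R n; apply; exists f; split=> //.
  exact: word_le_generated fx.
exact: word_length_le.
Qed.

(** This covers small [n], where the quadratic estimate says nothing. *)
Lemma distortion_gt0 n : (0 < n)%N -> (0 < distortion (C_gens R) (Fx_gens R) n)%N.
Proof.
move=> n0; have x0n := word_le_mono n0 (Fx_word_le_C word_le_x0).
apply: leq_trans (distortion_ge word_le_x0 x0n); rewrite lt0n; apply/eqP => l0.
have [k] := word_le_length (word_le_generated word_le_x0).
rewrite l0 leqn0 => /eqP -> [s [/size0nil -> _]]; rewrite big_nil.
move=> /(congr1 (fun f : PL2 R => f 0)); rewrite x0E add0r /= => /eqP.
by rewrite eq_sym oner_eq0.
Qed.

Lemma distortion_quadratic_lb m n : (3 * m <= n)%N ->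
  (m * m.-1 <= 22 * m + 2 * distortion (C_gens R) (Fx_gens R) n)%N.
Proof.
move=> mn; set c := (w0 R ^+ m * x1 R ^+ m * (w0 R ^+ m)^-1)%g.
have w0F : word_le (Fw_gens R) (w0 R ^+ m)%g (m * 1).
  by apply: word_leX; apply: word_le_gen; left.
have cx : word_le (Fx_gens R) c (m * (30 * (m * 1) + 3)).
  have -> : c = ((w0 R ^+ m * x1 R * (w0 R ^+ m)^-1) ^+ m)%g.
    (* As the m-th power of a conjugate of [x1], the element [c] lies in [F_x]. *)
    have := conjXg (x1 R) (w0 R ^+ m)^-1%g m.
    by rewrite !conjgE invgK !mulgA.
  exact/word_leX/word_le_conj_x1.
have cC : word_le (C_gens R) c n.
  apply: (@word_le_mono _ _ _ (m * 1 + m * 1 + m * 1)); first by lia.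
  have w0C : word_le (C_gens R) (w0 R ^+ m)%g (m * 1).
    by apply: word_leX; apply: word_le_gen; left; right.
  apply: word_leM; last exact: word_leV.
  by apply: word_leM => //; exact/word_leX/Fx_word_le_C/word_le_x1.
apply: leq_trans (conj_x1X_breakpoints (word_le_breakpoints
  (word_le_length (word_le_generated cx)))) _.
by rewrite leq_add2l leq_mul2l (distortion_ge cx).
Qed.

End PL2Theory.

Theorem theorem5p1 (R : realType) :
  (exists kappa1 kappa2 : R, [/\ 0 < kappa1, 0 < kappa2 &
     forall n : nat, (1 <= n)%N ->
       kappa1 * n%:R ^+ 2 <= (distortion (C_gens R) (Fx_gens R) n)%:R
         <= kappa2 * n%:R ^+ 2])
  /\
  (exists K : R, 0 < K /\
     forall x : PL2 R, generated (Fw_gens R) x ->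
       (word_length (Fw_gens R) x)%:R <= K * (word_length (C_gens R) x)%:R).
Proof.
split; last first.
  (* The constant is 1 because the [F_w] factor of a word of length n has length at most n. *)
  exists 1; split=> // f fw; rewrite mul1r ler_nat.
  apply/word_length_le/Fw_length_le => //; apply: word_le_length.
  have [m _ [s [sm sS sf]]] := word_le_length fw.
  apply/generatedP; exists m, s; split=> // y /sS.
  have sub z : Fw_gens R z -> C_gens R z by case=> ->; [left; right|right].
  by case=> /sub; [left|right].
exists (141 ^+ 2)^-1, 33; split; [by rewrite invr_gt0 exprn_gt0|by []|move=> n n0].
rewrite -!natrX -natrM ler_nat distortion_quadratic_ub andbT mulrC.
rewrite ler_pdivrMr ?ltr0n ?expn_gt0// -natrM ler_nat.
have d0 := distortion_gt0 R n0.
(* The conjugate with parameter m is a word of 3m letters in [C], whence m = n / 3. *)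
have := @distortion_quadratic_lb R (n %/ 3) n.
rewrite mulnC leq_divM => /(_ isT).
have : (n < 3 * (n %/ 3) + 3)%N by lia.
move: (distortion _ _ n) (n %/ 3)%N d0 => d m d0 nm dm.
(* For m at most 46, n is below 3 * 46 + 3 = 141 and positivity of [d] suffices. Beyond that, 23m is
   at most m^2 / 2, so m^2 - 23m <= 2d gives m^2 <= 4d, and n^2 <= 16 m^2 <= 64 d. *)
have [m46|m46] := leqP m 46.
  by apply: (@leq_trans (141 ^ 2)); [rewrite leq_exp2r//; lia|exact: leq_pmull].
have n4m : (n <= 4 * m)%N by lia.
have m4d : (m * m <= 4 * d)%N by nia.
have : (n ^ 2 <= (4 * m) ^ 2)%N by rewrite leq_exp2r.
move=> /leq_trans; apply; rewrite expnMn mulnC -[(m ^ 2)%N]/(m * m)%N.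
apply: (@leq_trans (4 * d * 4 ^ 2)); first by rewrite leq_mul2r m4d orbT.
by rewrite [(4 * d)%N]mulnC -mulnA leq_mul.
Qed.
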